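(* Let $\mathbf{k}$ be a commutative unital ring, $\Omega$ a nonempty set, $X$ a set disjoint from $\Omega$, and let $j_X:X\hookrightarrow\mathcal{F}(X,\Omega)$, $x\mapsto\bullet_x$, be the natural embedding. Then $(H_{RT}(X,\Omega),m_{RT},\mathbf{1},\Delta_\epsilon,\{B_\omega^+\mid\omega\in\Omega\})$ together with $j_X$ is the free $\Omega$-cocycle infinitesimal unitary bialgebra of weight zero on $X$.
   Context: An infinitesimal unitary bialgebra of weight $\lambda\in\mathbf{k}$ is a quadruple $(A,\mu,1,\Delta)$ with $(A,\mu,1)$ a unital associative algebra and $(A,\Delta)$ a coassociative coalgebra (possibly without counit) such that $\Delta(ab)=a\cdot\Delta(b)+\Delta(a)\cdot b+\lambda(a\otimes b)$ for all $a,b\in A$, where $a\cdot(b\otimes c)=ab\otimes c$ and $(b\otimes c)\cdot a=b\otimes ca$. A morphism of infinitesimal unitary bialgebras is a map that is both a morphism of unital algebras and a morphism of coalgebras. An $\Omega$-operated infinitesimal unitary bialgebra of weight $\lambda$ is an infinitesimal unitary bialgebra of weight $\lambda$ together with a family of linear operators $P_\omega:H\to H$, $\omega\in\Omega$; a morphism $\phi:(H,\{P_\omega\})\to(H',\{P'_\omega\})$ of such objects is a morphism of infinitesimal unitary bialgebras with $\phi\circ P_\omega=P'_\omega\circ\phi$ for all $\omega\in\Omega$. An $\Omega$-cocycle infinitesimal unitary bialgebra of weight $\lambda$ is an $\Omega$-operated infinitesimal unitary bialgebra $(H,m,1,\Delta,\{P_\omega\mid\omega\in\Omega\})$ of weight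 $\lambda$ such that $\Delta P_\omega=\mathrm{id}\otimes1+(\mathrm{id}\otimes P_\omega)\Delta$ for all $\omega\in\Omega$, i.e. $\Delta(P_\omega(h))=h\otimes 1+(\mathrm{id}\otimes P_\omega)\Delta(h)$. The free $\Omega$-cocycle infinitesimal unitary bialgebra of weight $\lambda$ on $X$ is an $\Omega$-cocycle infinitesimal unitary bialgebra $(H_X,m_X,1_X,\Delta_X,\{P_\omega\})$ of weight $\lambda$ together with a set map $j_X:X\to H_X$ such that, for any $\Omega$-cocycle infinitesimal unitary bialgebra $(H,m,1,\Delta,\{P'_\omega\})$ of weight $\lambda$ and any set map $f:X\to H$ with $\Delta(f(x))=1\otimes1$ for all $x\in X$, there is a unique morphism $\bar f:H_X\to H$ of $\Omega$-operated infinitesimal unitary bialgebras with $\bar f\circ j_X=f$. A planar rooted tree is a finite rooted tree with a fixed embedding in the plane (so the children of each vertex are ordered from left to right). $\mathcal{T}(X,\Omega)$ is the set of planar rooted trees with vertices decorated by $X\sqcup\Omega$ such that all internal (non-leaf) vertices are decorated by elements of $\Omega$, while leaves may be decorated by any element of $X\sqcup\Omega$; the vertex of a one-vertex tree counts as a leaf. $\bullet_x$ is the one-vertex tree decorated by $x$. $\mathcal{F}(X,\Omega)$ is the free monoid on $\mathcal{T}(X,\Omega)$ under concatenation $m_{RT}$, with unit the empty tree $\mathbf{1}$. $H_{RT}(X,\Omega):=\mathbf{k}\mathcal{F}(X,\Omega)$ is the free $\mathbf{k}$-module on $\mathcal{F}(X,\Omega)$, with multiplication the linear extension of $m_{RT}$.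 For $\omega\in\Omega$, $B_\omega^+:H_{RT}(X,\Omega)\to H_{RT}(X,\Omega)$ is the linear map sending $\mathbf{1}$ to $\bullet_\omega$ and a forest to the tree obtained by grafting its trees (in order) on a new root decorated by $\omega$. The linear map $\Delta_\epsilon:H_{RT}(X,\Omega)\to H_{RT}(X,\Omega)\otimes H_{RT}(X,\Omega)$ is defined recursively by: $\Delta_\epsilon(\mathbf{1})=0$; $\Delta_\epsilon(\bullet_x)=\mathbf{1}\otimes\mathbf{1}$ for $x\in X$; $\Delta_\epsilon(B_\omega^+(\overline F))=\overline F\otimes\mathbf{1}+(\mathrm{id}\otimes B_\omega^+)\Delta_\epsilon(\overline F)$ for $\overline F\in\mathcal{F}(X,\Omega)$, $\omega\in\Omega$; and $\Delta_\epsilon(T_1\cdots T_m)=T_1\cdot\Delta_\epsilon(T_2\cdots T_m)+\Delta_\epsilon(T_1)\cdot(T_2\cdots T_m)$ for $m\geq2$, $T_i\in\mathcal{T}(X,\Omega)$. *)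

(* Defs.v *)
From HB Require Import structures.
From mathcomp Require Import all_boot all_algebra finmap.
From mathcomp.multinomials Require Import monalg.
From mathcomp Require Import boolp.

Set Implicit Arguments.
Unset Strict Implicit.
Unset Printing Implicit Defensive.

Import GRing.Theory.
Local Open Scope ring_scope.

Declare Scope tensor_scope.
Delimit Scope tensor_scope with tens.
Local Open Scope tensor_scope.
Reserved Notation "A ⊗ B" (at level 40, left associativity).

(* The free module on K.  The type and its additive group are those of
   {malg R[K]}, but the library's module structure on the latter needs a
   nontrivial R. *)
Definition free_mod (R : pzRingType) (K : choiceType) : Type := {malg R[K]}.

Section FreeModule.
Variables (R : pzRingType) (K : choiceType).
HB.instance Definition _ := GRing.Zmodule.copy (free_mod R K) {malg R[K]}.
Implicit Types (g h : free_mod R K) (a b : R).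

Definition free_scale a g : free_mod R K := [malg x in msupp g => a * mcoeff x g].

Lemma free_scaleE a g x : mcoeff x (free_scale a g) = a * mcoeff x g.
Proof. by rewrite mcoeffE; case: msuppP; rewrite ?mulr0. Qed.

Fact free_scaleA a b g : free_scale a (free_scale b g) = free_scale (a * b) g.
Proof. by apply/malgP=> x; rewrite !free_scaleE mulrA. Qed.
Fact free_scale1 : left_id 1 free_scale.
Proof. by move=> g; apply/malgP=> x; rewrite !free_scaleE mul1r. Qed.
Fact free_scaleDr : right_distributive free_scale +%R.
Proof.
move=> a g h; apply/malgP=> x.
by rewrite free_scaleE !mcoeffD !free_scaleE mulrDr.
Qed.
Fact free_scaleDl g : {morph free_scale^~ g : a b / a + b}.
Proof.
by move=> a b; apply/malgP=> x; rewrite mcoeffD !free_scaleE mulrDl.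
Qed.
HB.instance Definition _ := GRing.Zmodule_isLmodule.Build R (free_mod R K)
  free_scaleA free_scale1 free_scaleDr free_scaleDl.

Lemma free_coefZ a g x : mcoeff x (a *: g) = a * mcoeff x g.
Proof. exact: free_scaleE. Qed.

Lemma free_coefD g h x : mcoeff x (g + h) = mcoeff x g + mcoeff x h.
Proof. exact: mcoeffD. Qed.

Definition basis (x : K) : free_mod R K := << 1 *g x >>.

Lemma free_modE g : g = \sum_(x <- msupp g) mcoeff x g *: basis x.
Proof.
rewrite {1}[g]monalgE; apply: eq_bigr => x _; apply/malgP=> y.
by rewrite free_coefZ !mcoeffU mulr_natr.
Qed.

(* Linear extension of a map defined on the basis. *)
Definition free_lift (V : lmodType R) (f : K -> V) g : V :=
  \sum_(x <- msupp g) mcoeff x g *: f x.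

Lemma free_liftw (V : lmodType R) (f : K -> V) (d : {fset K}) g :
  fsubset (msupp g) d -> free_lift f g = \sum_(x <- d) mcoeff x g *: f x.
Proof.
move=> sgd; rewrite /free_lift; apply: big_fset_incl => // x _ xg.
by rewrite mcoeff_outdom ?scale0r.
Qed.

Fact free_lift_is_linear (V : lmodType R) (f : K -> V) : linear (free_lift f).
Proof.
move=> a g h; pose d := fsetU (msupp g) (fsetU (msupp h) (msupp (a *: g + h))).
have sg : fsubset (msupp g) d by rewrite /d fsubsetUl.
have sh : fsubset (msupp h) d by rewrite /d fsetUCA fsubsetUl.
have sgh : fsubset (msupp (a *: g + h)) d by rewrite /d fsetUA fsubsetUr.
rewrite (free_liftw f sgh) (free_liftw f sg) (free_liftw f sh) scaler_sumr.
rewrite -big_split; apply: eq_bigr => x _ /=.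
by rewrite free_coefD free_coefZ scalerDl scalerA.
Qed.
HB.instance Definition _ (V : lmodType R) (f : K -> V) :=
  GRing.isLinear.Build R (free_mod R K) V *:%R (free_lift f)
    (free_lift_is_linear f).

Lemma free_lift_basis (V : lmodType R) (f : K -> V) x :
  free_lift f (basis x) = f x.
Proof.
rewrite (free_liftw f (msuppU_le : fsubset (msupp (basis x)) _)).
by rewrite big_seq_fset1 mcoeffUU scale1r.
Qed.

Lemma free_mod_ext (V : lmodType R) (u v : {linear free_mod R K -> V}) :
  (forall x, u (basis x) = v (basis x)) -> u =1 v.
Proof.
move=> uv g; rewrite [g]free_modE !linear_sum; apply: eq_bigr => x _.
by rewrite !linearZ uv.
Qed.

End FreeModule.

(* Tensor product of k-modules: the free module on A * B modulo the submodule
   spanned by the bilinearity relations. *)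
Section Tensor.
Variables (k : comPzRingType) (A B : lmodType k).
Local Notation F := (free_mod k (A * B)%type).
Local Notation e a b := (basis k ((a, b) : (A * B)%type)).

Inductive bilin_span : F -> Prop :=
| bilin_addl a a' b : bilin_span (e (a + a') b - (e a b + e a' b))
| bilin_addr a b b' : bilin_span (e a (b + b') - (e a b + e a b'))
| bilin_scalel c a b : bilin_span (e (c *: a) b - c *: e a b)
| bilin_scaler c a b : bilin_span (e a (c *: b) - c *: e a b)
| bilin_span0 : bilin_span 0
| bilin_spanD u v : bilin_span u -> bilin_span v -> bilin_span (u + v)
| bilin_spanZ c u : bilin_span u -> bilin_span (c *: u).

Definition bilin_submod : {pred F} := fun u => `[< bilin_span u >].

Fact bilin_submod_closed : zmod_closed bilin_submod.
Proof.
split=> [|u v /asboolP su /asboolP sv]; apply/asboolP.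
  exact: bilin_span0.
by rewrite -scaleN1r; apply: bilin_spanD => //; apply: bilin_spanZ.
Qed.
HB.instance Definition _ :=
  GRing.isZmodClosed.Build F bilin_submod bilin_submod_closed.

Definition tensor : Type := @Quotient.quot F bilin_submod.
HB.instance Definition _ := GRing.Zmodule.on tensor.
HB.instance Definition _ := Choice.on tensor.

Definition tpi (u : F) : tensor := \pi_(@Quotient.quot F bilin_submod)%qT u.
Definition trepr (t : tensor) : F := @repr _ (@Quotient.quot F bilin_submod) t.

Lemma treprK : cancel trepr tpi. Proof. exact: reprK. Qed.
Lemma tpiP u v : tpi u = tpi v <-> bilin_span (u - v).
Proof.
split=> [/eqP|uv].
  by rewrite -Quotient.idealrBE => /asboolP.
by apply/eqP; rewrite -Quotient.idealrBE; apply/asboolP.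
Qed.
Lemma tpiD u v : tpi (u + v) = tpi u + tpi v.
Proof. exact: (@Quotient.pi_add F bilin_submod). Qed.

Definition tensor_scale (c : k) (t : tensor) : tensor := tpi (c *: trepr t).

Lemma tpiZ c u : tensor_scale c (tpi u) = tpi (c *: u).
Proof.
by apply/tpiP; rewrite -scalerBr; apply/bilin_spanZ/tpiP; rewrite treprK.
Qed.

Fact tensor_scaleA c d t :
  tensor_scale c (tensor_scale d t) = tensor_scale (c * d) t.
Proof. by rewrite -[t]treprK !tpiZ scalerA. Qed.
Fact tensor_scale1 : left_id 1 tensor_scale.
Proof. by move=> t; rewrite -[t]treprK tpiZ scale1r. Qed.
Fact tensor_scaleDr : right_distributive tensor_scale +%R.
Proof.
move=> c t u; rewrite -[t]treprK -[u]treprK -tpiD !tpiZ -tpiD.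
by rewrite scalerDr.
Qed.
Fact tensor_scaleDl t : {morph tensor_scale^~ t : c d / c + d}.
Proof. by move=> c d; rewrite -[t]treprK !tpiZ -tpiD scalerDl. Qed.
HB.instance Definition _ := GRing.Zmodule_isLmodule.Build k tensor
  tensor_scaleA tensor_scale1 tensor_scaleDr tensor_scaleDl.

Fact tpi_is_linear : linear tpi.
Proof. by move=> c u v; rewrite tpiD -tpiZ. Qed.
HB.instance Definition _ := GRing.isLinear.Build k F tensor *:%R tpi tpi_is_linear.

Definition tens (a : A) (b : B) : tensor := tpi (e a b).

Definition bilinear_map (M : lmodType k) (f : A -> B -> M) : Prop :=
  (forall b, linear (f^~ b)) /\ (forall a, linear (f a)).

Lemma tens_bilinear : bilinear_map tens.
Proof.
have splitE (x y p q : F) : x - (p + q) = (x - (y + q)) + (y - p).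
  by rewrite -(addrKA q y p) subrKA (addrC q).
split=> [b c a a'|a c b b'] /=; rewrite /tens -linearZ -linearD /=; apply/tpiP.
  rewrite (splitE _ (e (c *: a) b)).
  by apply: bilin_spanD; [exact: bilin_addl | exact: bilin_scalel].
rewrite (splitE _ (e a (c *: b))).
by apply: bilin_spanD; [exact: bilin_addr | exact: bilin_scaler].
Qed.

(* The linear map induced by a bilinear f; junk when f is not bilinear. *)
Definition tensor_lift (M : lmodType k) (f : A -> B -> M) (t : tensor) : M :=
  free_lift (fun p => f p.1 p.2) (trepr t).

Section Lift.
Variables (M : lmodType k) (f : A -> B -> M).
Hypothesis f_bilin : bilinear_map f.

Lemma tensor_lift_pi u :
  tensor_lift f (tpi u) = free_lift (fun p => f p.1 p.2) u.
Proof.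
case: f_bilin => fl fr.
apply/eqP; rewrite -subr_eq0 -linearB; apply/eqP.
have : bilin_span (trepr (tpi u) - u) by apply/tpiP; rewrite treprK.
elim=> [a a' b|a b b'|c a b|c a b||v w _ IHv _ IHw|c v _ IHv] /=.
- rewrite linearB linearD /= !free_lift_basis /=.
  by have /= := fl b 1 a a'; rewrite !scale1r => ->; rewrite subrr.
- rewrite linearB linearD /= !free_lift_basis /=.
  by have /= := fr a 1 b b'; rewrite !scale1r => ->; rewrite subrr.
- rewrite linearB linearZ /= !free_lift_basis /=.
  by rewrite (scalable_linear (fl b)) subrr.
- rewrite linearB linearZ /= !free_lift_basis /=.
  by rewrite (scalable_linear (fr a)) subrr.
- exact: linear0.
- by rewrite linearD /= IHv IHw addr0.
- by rewrite linearZ /= IHv scaler0.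
Qed.

Lemma tensor_liftE a b : tensor_lift f (tens a b) = f a b.
Proof. by rewrite tensor_lift_pi free_lift_basis. Qed.

Lemma tensor_lift_linear : linear (tensor_lift f).
Proof.
move=> c t u; rewrite -[t]treprK -[u]treprK -linearZ -linearD.
by rewrite !tensor_lift_pi linearD linearZ.
Qed.
End Lift.

Lemma tensor_ext (M : lmodType k) (u v : {linear tensor -> M}) :
  (forall a b, u (tens a b) = v (tens a b)) -> u =1 v.
Proof.
move=> uv t; rewrite -[t]treprK.
by apply: (@free_mod_ext _ _ _ (u \o tpi) (v \o tpi)) => -[a b]; exact: uv.
Qed.

End Tensor.

Arguments tensor {k} (A B)%_type_scope.
Notation "A ⊗ B" := (tensor A B) : type_scope.
Notation "a ⊗ b" := (tens a b) : tensor_scope.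

Section TensorMaps.
Variable k : comPzRingType.

Definition tens_map (A A' B B' : lmodType k) (f : A -> A') (g : B -> B') :
    A ⊗ B -> A' ⊗ B' :=
  tensor_lift (fun a b => f a ⊗ g b).

Section Linear.
Variables (A A' B B' : lmodType k).
Variables (f : {linear A -> A'}) (g : {linear B -> B'}).

Fact tens_map_bilinear : bilinear_map (fun a b => f a ⊗ g b).
Proof.
have [tl tr] := tens_bilinear A' B'.
by split=> [b c a a'|a c b b'] /=; rewrite linearP /= (tl, tr).
Qed.

Lemma tens_mapE a b : tens_map f g (a ⊗ b) = f a ⊗ g b.
Proof. exact: (tensor_liftE tens_map_bilinear). Qed.

HB.instance Definition _ := GRing.isLinear.Build k (A ⊗ B)%type (A' ⊗ B')%type *:%R
  (tens_map f g) (tensor_lift_linear tens_map_bilinear).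
End Linear.

Definition tens_assoc (A B C : lmodType k) : (A ⊗ B) ⊗ C -> A ⊗ (B ⊗ C) :=
  tensor_lift (fun t c => tensor_lift (fun a b => a ⊗ (b ⊗ c)) t).

Section Assoc.
Variables (A B C : lmodType k).

Fact tens_assoc_bilinear_in c :
  bilinear_map (fun (a : A) (b : B) => a ⊗ (b ⊗ (c : C))).
Proof.
have [tl tr] := tens_bilinear A (B ⊗ C)%type; have [tl' tr'] := tens_bilinear B C.
by split=> [b d a a'|a d b b'] /=; [exact: tl | rewrite tl' tr].
Qed.

Fact tens_assoc_bilinear : bilinear_map
  (fun t (c : C) => tensor_lift (fun (a : A) (b : B) => a ⊗ (b ⊗ c)) t).
Proof.
have [tl tr] := tens_bilinear A (B ⊗ C)%type; have [tl' tr'] := tens_bilinear B C.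
split=> [c|t d c c']; first exact: tensor_lift_linear (tens_assoc_bilinear_in c).
rewrite /= /tensor_lift /free_lift scaler_sumr -big_split; apply: eq_bigr => -[a b] _ /=.
by rewrite tr' tr scalerDr !scalerA mulrC.
Qed.

Lemma tens_assocE (a : A) (b : B) (c : C) :
  tens_assoc ((a ⊗ b) ⊗ c) = a ⊗ (b ⊗ c).
Proof.
rewrite /tens_assoc (tensor_liftE tens_assoc_bilinear).
exact: (tensor_liftE (tens_assoc_bilinear_in c)).
Qed.

HB.instance Definition _ := GRing.isLinear.Build k ((A ⊗ B) ⊗ C)%type
  (A ⊗ (B ⊗ C))%type *:%R (@tens_assoc A B C) (tensor_lift_linear tens_assoc_bilinear).
End Assoc.
End TensorMaps.

(* Unital associative k-algebras.  The library's algType requires 1 != 0, which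
   would exclude the zero algebra and a trivial k. *)
Record ualgType (k : comPzRingType) := UAlg {
  ualg_mod : lmodType k;
  ualg_mul : ualg_mod -> ualg_mod -> ualg_mod;
  ualg_one : ualg_mod;
  ualg_mulA : associative ualg_mul;
  ualg_mul1l : left_id ualg_one ualg_mul;
  ualg_mul1r : right_id ualg_one ualg_mul;
  ualg_mul_bilin : bilinear_map ualg_mul
}.

Definition ualg_sort k (A : ualgType k) : Type := ualg_mod A.
Coercion ualg_sort : ualgType >-> Sortclass.

Section UAlgTheory.
Variables (k : comPzRingType) (A : ualgType k).
HB.instance Definition _ := GRing.Lmodule.copy (ualg_sort A) (ualg_mod A).

Fact ualg_mulDl : left_distributive (@ualg_mul k A) +%R.
Proof.
move=> a b c; have [l _] := ualg_mul_bilin A.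
by have /= := l c 1 a b; rewrite !scale1r.
Qed.
Fact ualg_mulDr : right_distributive (@ualg_mul k A) +%R.
Proof.
move=> a b c; have [_ r] := ualg_mul_bilin A.
by have /= := r a 1 b c; rewrite !scale1r.
Qed.
HB.instance Definition _ := GRing.Zmodule_isPzRing.Build (ualg_sort A)
  (@ualg_mulA k A) (@ualg_mul1l k A) (@ualg_mul1r k A) ualg_mulDl ualg_mulDr.

Lemma ualg_scaleAl (c : k) (a b : A) : c *: (a * b) = (c *: a) * b.
Proof. exact/esym/(scalable_linear ((ualg_mul_bilin A).1 b)). Qed.
Lemma ualg_scaleAr (c : k) (a b : A) : c *: (a * b) = a * (c *: b).
Proof. exact/esym/(scalable_linear ((ualg_mul_bilin A).2 a)). Qed.

Definition ualg_mull (a b : A) : A := a * b.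
Definition ualg_mulr (a b : A) : A := b * a.
HB.instance Definition _ a :=
  GRing.isLinear.Build k A A *:%R (ualg_mull a) ((ualg_mul_bilin A).2 a).
HB.instance Definition _ a :=
  GRing.isLinear.Build k A A *:%R (ualg_mulr a) ((ualg_mul_bilin A).1 a).
End UAlgTheory.

Definition ualg_lmod k (A : ualgType k) : lmodType k := ualg_sort A.
Coercion ualg_lmod : ualgType >-> GRing.Lmodule.type.

Notation comultiplication A := {linear A -> (A ⊗ A)%type}.

Section Bialgebras.
Variables (k : comPzRingType) (Omega : Type) (lambda : k).
Implicit Type A : ualgType k.

(* The A-bimodule structure a.(b ⊗ c) = ab ⊗ c, (b ⊗ c).a = b ⊗ ca. *)
Definition lact A (a : A) : A ⊗ A -> A ⊗ A := tens_map (ualg_mull a) idfun.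
Definition ract A (t : A ⊗ A) (a : A) : A ⊗ A := tens_map idfun (ualg_mulr a) t.

Definition coassociative A (Delta : A -> A ⊗ A) : Prop :=
  forall a,
    tens_assoc (tens_map Delta idfun (Delta a)) = tens_map idfun Delta (Delta a).

Record inf_unitary_bialgebra A (Delta : comultiplication A) : Prop := {
  inf_coassociative : coassociative Delta;
  inf_comul_mul : forall a b : A,
    Delta (a * b) = lact a (Delta b) + ract (Delta a) b + lambda *: (a ⊗ b)
}.

Record cocycle_inf_unitary_bialgebra A (Delta : comultiplication A)
    (P : Omega -> {linear A -> A}) : Prop := {
  cocycle_bialgebra : inf_unitary_bialgebra Delta;
  cocycle_comul : forall w (a : A),
    Delta (P w a) = a ⊗ (1 : A) + tens_map idfun (P w) (Delta a)
}.

Record operated_bialgebra_morphism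
    A (Delta : comultiplication A) (P : Omega -> {linear A -> A})
    A' (Delta' : comultiplication A') (P' : Omega -> {linear A' -> A'})
    (phi : A -> A') : Prop := {
  morphism_linear : linear phi;
  morphism_one : phi 1 = 1;
  morphism_mul : {morph phi : a b / a * b};
  morphism_comul : forall a, Delta' (phi a) = tens_map phi phi (Delta a);
  morphism_operator : forall w a, phi (P w a) = P' w (phi a)
}.

Definition free_cocycle_inf_unitary_bialgebra (X : Type)
    A (Delta : comultiplication A) (P : Omega -> {linear A -> A})
    (j : X -> A) : Prop :=
  cocycle_inf_unitary_bialgebra Delta P /\
  forall A' (Delta' : comultiplication A') (P' : Omega -> {linear A' -> A'}),
    cocycle_inf_unitary_bialgebra Delta' P' ->
    forall f : X -> A', (forall x, Delta' (f x) = (1 : A') ⊗ (1 : A')) ->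
    exists! phi : A -> A',
      operated_bialgebra_morphism Delta P Delta' P' phi /\ phi \o j = f.
End Bialgebras.

(* Planar rooted trees decorated by X + Omega whose internal vertices are
   decorated by Omega: an element of X can only decorate a childless vertex,
   and Node w [::] is the one-vertex tree decorated by w. *)
Inductive dtree (X Omega : Type) : Type :=
| Leaf of X
| Node of Omega & seq (dtree X Omega).
Arguments Leaf {X Omega}.
Arguments Node {X Omega}.

Section TreeChoice.
Variables (X Omega : choiceType).

Fixpoint dtree_encode (t : dtree X Omega) : GenTree.tree (X + Omega)%type :=
  match t with
  | Leaf x => GenTree.Leaf (inl x)
  | Node w F => GenTree.Node 0 (GenTree.Leaf (inr w) :: map dtree_encode F)
  end.

Fixpoint dtree_decode (t : GenTree.tree (X + Omega)%type) :
    option (dtree X Omega) :=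
  match t with
  | GenTree.Leaf (inl x) => Some (Leaf x)
  | GenTree.Node _ (GenTree.Leaf (inr w) :: F) =>
      Some (Node w (pmap dtree_decode F))
  | _ => None
  end.

Fact dtree_encodeK : pcancel dtree_encode dtree_decode.
Proof.
rewrite /pcancel; fix IH 1 => -[x|w F] //=; congr (Some (Node w _)).
by elim: F => //= t F ->; rewrite IH.
Qed.

HB.instance Definition _ := Choice.copy (dtree X Omega) (pcan_type dtree_encodeK).
End TreeChoice.

Section ForestAlgebra.
Variables (k : comPzRingType) (X Omega : choiceType).
Local Notation tree := (dtree X Omega).
Local Notation forest := (seq tree).
Local Notation kF := (free_mod k forest).

Definition forest_mul (g h : kF) : kF :=
  free_lift (fun F => free_lift (fun G => basis k (F ++ G)) h) g.

Fact forest_mul_bilinear : bilinear_map forest_mul.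
Proof.
have mulE g h : forest_mul g h = \sum_(F <- msupp g)
    mcoeff F g *: free_lift (fun G => basis k (F ++ G)) h by [].
split=> [h|g c h h']; first exact: free_lift_is_linear.
rewrite !mulE scaler_sumr -big_split; apply: eq_bigr => F _ /=.
by rewrite linearP scalerDr !scalerA mulrC.
Qed.

Lemma forest_mul_basis F G :
  forest_mul (basis k F) (basis k G) = basis k (F ++ G).
Proof. by rewrite /forest_mul !free_lift_basis. Qed.

Fact forest_mul1l : left_id (basis k [::]) forest_mul.
Proof.
move=> g; rewrite /forest_mul free_lift_basis.
apply: (@free_mod_ext k _ kF (free_lift (fun G => basis k ([::] ++ G))) idfun).
by move=> F; rewrite /= free_lift_basis.
Qed.

Fact forest_mul1r : right_id (basis k [::]) forest_mul.
Proof.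
move=> g; rewrite {2}[g]free_modE; apply: eq_bigr => F _.
by rewrite free_lift_basis cats0.
Qed.

Fact forest_mulA : associative forest_mul.
Proof.
pose cat_l F : {linear kF -> kF} := free_lift (fun G => basis k (F ++ G)).
pose mul_r h : {linear kF -> kF} := free_lift (fun F => cat_l F h).
move=> g h u; rewrite -[RHS]/((mul_r u \o mul_r h) g).
apply: (@free_mod_ext k _ kF (mul_r (forest_mul h u))) => F.
rewrite /= !free_lift_basis -[LHS]/((cat_l F \o mul_r u) h).
rewrite -[RHS]/((mul_r u \o cat_l F) h); apply: free_mod_ext => G.
rewrite /= !free_lift_basis -[LHS]/((cat_l F \o cat_l G) u).
apply: free_mod_ext => H; by rewrite /= !free_lift_basis catA.
Qed.

Definition H_RT : ualgType k := UAlg forest_mulA forest_mul1l forest_mul1r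
  forest_mul_bilinear.

(* A forest as a basis element of H_RT; the empty forest is the unit. *)
Definition forest_elt (F : forest) : H_RT := basis k F.

Lemma forest_elt_nil : forest_elt [::] = 1. Proof. by []. Qed.

Lemma forest_elt_cat F G : forest_elt (F ++ G) = forest_elt F * forest_elt G.
Proof. exact/esym/forest_mul_basis. Qed.

Definition Bplus (w : Omega) : {linear H_RT -> H_RT} :=
  free_lift (fun F => forest_elt [:: Node w F]).

Lemma Bplus_forest w F : Bplus w (forest_elt F) = forest_elt [:: Node w F].
Proof. exact: free_lift_basis. Qed.

Definition Delta_forest (D : tree -> (H_RT ⊗ H_RT)%type) :=
  fix Df (F : forest) : (H_RT ⊗ H_RT)%type :=
    match F with
    | [::] => 0
    | [:: T] => D T
    | T :: F' => lact (forest_elt [:: T]) (Df F') + ract (D T) (forest_elt F')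
    end.

Fixpoint Delta_tree (T : tree) : (H_RT ⊗ H_RT)%type :=
  match T with
  | Leaf _ => (1 : H_RT) ⊗ (1 : H_RT)
  | Node w F => forest_elt F ⊗ (1 : H_RT)
                + tens_map idfun (Bplus w) (Delta_forest Delta_tree F)
  end.

Definition Delta_eps : comultiplication H_RT :=
  free_lift (Delta_forest Delta_tree).

Lemma Delta_eps_forest F :
  Delta_eps (forest_elt F) = Delta_forest Delta_tree F.
Proof. exact: free_lift_basis. Qed.

Lemma Delta_eps_one : Delta_eps 1 = 0.
Proof. exact: (Delta_eps_forest [::]). Qed.

Lemma Delta_eps_leaf x :
  Delta_eps (forest_elt [:: Leaf x]) = (1 : H_RT) ⊗ (1 : H_RT).
Proof. exact: Delta_eps_forest. Qed.

Lemma Delta_eps_Bplus w F : Delta_eps (Bplus w (forest_elt F)) =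
  forest_elt F ⊗ (1 : H_RT) + tens_map idfun (Bplus w) (Delta_eps (forest_elt F)).
Proof. by rewrite Bplus_forest !Delta_eps_forest. Qed.

Lemma Delta_eps_cons T F : F != [::] -> Delta_eps (forest_elt (T :: F)) =
  lact (forest_elt [:: T]) (Delta_eps (forest_elt F))
  + ract (Delta_eps (forest_elt [:: T])) (forest_elt F).
Proof. by rewrite !Delta_eps_forest; case: F. Qed.

Definition j_X (x : X) : H_RT := forest_elt [:: Leaf x].

End ForestAlgebra.

Arguments Bplus k {X Omega} w.
Arguments Delta_eps k X Omega.
Arguments j_X k {X} Omega x.

(* Main.v *)
From HB Require Import structures.
Require Import Defs.
From mathcomp Require Import all_boot all_algebra.
From mathcomp Require boolp.
Import GRing.Theory.
Local Open Scope ring_scope.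

(** The theorem holds because H_RT is generated, as an algebra with operators
    B_w^+, by the one-vertex trees decorated by X, and freely so: a forest can
    be read in exactly one way as a product of trees, each of which is either
    such a leaf or some B_w^+ of a smaller forest.

    Freeness gives existence.  For a target algebra A with operators P_w and
    values f x, recursion on trees defines the only possible map, sending a
    leaf x to f x and B_w^+(F) to P_w of the image of F ([forest_map]).

    Generation gives everything else.  By [forest_algebra_ind], a property that
    is stable under linear combinations, products and the operators B_w^+ holds
    on H_RT as soon as it holds for 1 and the leaves.  This is applied to
    coassociativity of Delta_eps at an element, to compatibility of
    [forest_map] with the coproducts at an element, and to agreement with
    another morphism at an element.  That the first two properties have these
    stabilities follows, in any algebra, from the two rules
    Delta(ab) = a.Delta(b) + Delta(a).b and
    Delta(P a) = a (x) 1 + (id (x) P) Delta(a).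

    The interesting case is that of coassociativity at a product.  Expanding
    (Delta (x) id) Delta(ab) and (id (x) Delta) Delta(ab) by the first rule,
    both produce the same term sum a_1 (x) a_2 b_1 (x) b_2 ([cross]), and
    the rest is the same side of the identity for b with a acting on its first
    factor, plus that of the identity for a with b acting on its last factor
    ([coassociative_at_mul]).  For P a, the second
    rule turns both sides into Delta(a) (x) 1 plus P applied to the last factor
    of the identity for a, up to a term a (x) Delta(1); and the first rule forces
    Delta(1) = 0 ([coassociative_at_op], [leibniz_one]).

    The first rule for Delta_eps is not its definition, which only peels off the
    leftmost tree of a forest; it follows because the elements a that satisfy it
    against every b form a subalgebra containing all trees
    ([Delta_eps_leibniz]). *)

Set Implicit Arguments.
Unset Strict Implicit.
Unset Printing Implicit Defensive.

(** * Tensor products, by their pure tensors *)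

(** What the coproduct identities use of a tensor product: functoriality and
    associativity as linear maps given on pure tensors, and generation by pure
    tensors, which reduces an identity between additive maps to these. *)
Record tensor_theory (k : comPzRingType) := TensorTheory {
  tprod : lmodType k -> lmodType k -> lmodType k;
  pure : forall A B : lmodType k, A -> B -> tprod A B;
  tmap : forall A A' B B' : lmodType k,
    (A -> A') -> (B -> B') -> tprod A B -> tprod A' B';
  tassoc : forall A B C : lmodType k,
    tprod (tprod A B) C -> tprod A (tprod B C);
  pure_bilinear : forall A B, bilinear_map (@pure A B);
  tprod_ind : forall A B (P : tprod A B -> Prop),
    (forall t u, P t -> P u -> P (t + u)) -> (forall a b, P (pure a b)) ->
    forall t, P t;
  tmap_linear : forall (A A' B B' : lmodType k)
    (f : {linear A -> A'}) (g : {linear B -> B'}), linear (tmap f g);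
  tmapE : forall (A A' B B' : lmodType k)
    (f : {linear A -> A'}) (g : {linear B -> B'}) a b,
    tmap f g (pure a b) = pure (f a) (g b);
  tassoc_linear : forall A B C, linear (@tassoc A B C);
  tassocE : forall (A B C : lmodType k) (a : A) (b : B) (c : C),
    tassoc (pure (pure a b) c) = pure a (pure b c)
}.

Section AbstractTensors.
Variables (k : comPzRingType) (T : tensor_theory k).
Local Notation "a ⊗ b" := (pure T a b) : ring_scope.
Variables A A' B B' C : lmodType k.

Lemma pureDl (a a' : A) (b : B) : (a + a') ⊗ b = a ⊗ b + a' ⊗ b.
Proof. by have /= := (pure_bilinear T A B).1 b 1 a a'; rewrite !scale1r. Qed.
Lemma pureDr (a : A) (b b' : B) : a ⊗ (b + b') = a ⊗ b + a ⊗ b'.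
Proof. by have /= := (pure_bilinear T A B).2 a 1 b b'; rewrite !scale1r. Qed.
Lemma pureZl c (a : A) (b : B) : (c *: a) ⊗ b = c *: (a ⊗ b).
Proof. exact: (scalable_linear ((pure_bilinear T A B).1 b)). Qed.
Lemma pureZr c (a : A) (b : B) : a ⊗ (c *: b) = c *: (a ⊗ b).
Proof. exact: (scalable_linear ((pure_bilinear T A B).2 a)). Qed.
Lemma pure0l (b : B) : (0 : A) ⊗ b = 0.
Proof. by rewrite -(scale0r 0) pureZl scale0r. Qed.
Lemma pure0r (a : A) : a ⊗ (0 : B) = 0.
Proof. by rewrite -(scale0r 0) pureZr scale0r. Qed.

HB.instance Definition _ (f : {linear A -> A'}) (g : {linear B -> B'}) :=
  GRing.isLinear.Build k (tprod T A B) (tprod T A' B') *:%R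
    (@tmap k T A A' B B' f g) (@tmap_linear k T A A' B B' f g).

HB.instance Definition _ :=
  GRing.isLinear.Build k (tprod T (tprod T A B) C) (tprod T A (tprod T B C)) *:%R
    (@tassoc k T A B C) (@tassoc_linear k T A B C).

Lemma tmapD (f : {linear A -> A'}) (g : {linear B -> B'}) (t u : tprod T A B) :
  tmap f g (t + u) = tmap f g t + tmap f g u.
Proof. exact: linearD. Qed.
Lemma tassocD (t u : tprod T (tprod T A B) C) :
  tassoc (t + u) = tassoc t + tassoc u.
Proof. exact: linearD. Qed.

End AbstractTensors.

(** * Coproducts obeying a Leibniz rule *)

Section Comultiplication.
Variables (k : comPzRingType) (T : tensor_theory k).
Local Notation "a ⊗ b" := (pure T a b) : ring_scope.
Local Notation "A ⊠ B" := (tprod T A B) (at level 40).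

(** The product is carried by its two families of translations, so that each
    can be tensored with an identity to give the bimodule structure on the
    tensor square; [mulrE] says that they come from one product. *)
Section OneAlgebra.
Variables (M : lmodType k) (mull mulr : M -> {linear M -> M}) (one : M).
Hypothesis mulrE : forall a b, mulr b a = mull a b.
Hypothesis mullA : forall a b c, mull (mull a b) c = mull a (mull b c).
Hypothesis mul1l : forall a, mull one a = a.
Hypothesis mul1r : forall a, mull a one = a.
Implicit Types (a b c x : M) (t u v : M ⊠ M).

Definition actl a t := tmap (mull a) idfun t.
Definition actr t a := tmap idfun (mulr a) t.

Lemma actlE a b c : actl a (b ⊗ c) = mull a b ⊗ c.
Proof. exact: tmapE. Qed.
Lemma actrE a b c : actr (b ⊗ c) a = b ⊗ mull c a.
Proof. by rewrite /actr tmapE mulrE. Qed.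
Lemma actlDr a t u : actl a (t + u) = actl a t + actl a u.
Proof. exact: linearD. Qed.
Lemma actlZr a (c : k) t : actl a (c *: t) = c *: actl a t.
Proof. exact: linearZ. Qed.
Lemma actrDl t u a : actr (t + u) a = actr t a + actr u a.
Proof. exact: linearD. Qed.
Lemma actrZl (c : k) t a : actr (c *: t) a = c *: actr t a.
Proof. exact: linearZ. Qed.

Lemma actl_linear t : linear (actl^~ t).
Proof.
move=> c a b /=; elim/tprod_ind: t => [t u|d e].
  by rewrite !actlDr => -> ->; rewrite scalerDr addrACA.
by rewrite !actlE -!mulrE linearP pureDl pureZl.
Qed.

Lemma actr_linear t : linear (actr t).
Proof.
move=> c a b; elim/tprod_ind: t => [t u|d e].
  by rewrite !actrDl => -> ->; rewrite scalerDr addrACA.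
by rewrite !actrE linearP pureDr pureZr.
Qed.

Lemma actl1 t : actl one t = t.
Proof.
by elim/tprod_ind: t => [t u|b c]; rewrite ?actlDr ?actlE ?mul1l // => -> ->.
Qed.
Lemma actr1 t : actr t one = t.
Proof.
by elim/tprod_ind: t => [t u|b c]; rewrite ?actrDl ?actrE ?mul1r // => -> ->.
Qed.
Lemma actlM a b t : actl (mull a b) t = actl a (actl b t).
Proof.
by elim/tprod_ind: t => [t u|c d]; rewrite ?actlDr ?actlE ?mullA // => -> ->.
Qed.
Lemma actrM t a b : actr t (mull a b) = actr (actr t a) b.
Proof.
by elim/tprod_ind: t => [t u|c d]; rewrite ?actrDl ?actrE ?mullA // => -> ->.
Qed.
Lemma actl_actr a t b : actr (actl a t) b = actl a (actr t b).
Proof.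
elim/tprod_ind: t => [t u|c d]; last by rewrite actlE !actrE actlE.
by rewrite !(actlDr, actrDl) => -> ->.
Qed.

Variable Delta : {linear M -> M ⊠ M}.

Definition leibniz a b :=
  Delta (mull a b) = actl a (Delta b) + actr (Delta a) b.

Lemma leibniz_linearl (c : k) a a' b :
  leibniz a b -> leibniz a' b -> leibniz (c *: a + a') b.
Proof.
rewrite /leibniz => Ha Ha'; rewrite -mulrE linearP !mulrE !(linearP Delta) Ha Ha'.
by rewrite (actl_linear (Delta b)) actrDl actrZl scalerDr addrACA.
Qed.

Lemma leibniz_linearr (c : k) a b b' :
  leibniz a b -> leibniz a b' -> leibniz a (c *: b + b').
Proof.
rewrite /leibniz => Hb Hb'; rewrite linearP !(linearP Delta) Hb Hb'.
by rewrite actlDr actlZr actr_linear scalerDr addrACA.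
Qed.

(** Both sides of the rule for (a a') b are computed from a (a' b); associativity
    of the product and the bimodule axioms identify the three resulting terms. *)
Lemma leibnizMl a a' b :
  leibniz a a' -> leibniz a (mull a' b) -> leibniz a' b -> leibniz (mull a a') b.
Proof.
rewrite /leibniz => Ha Hab Ha'; rewrite mullA Hab Ha' Ha.
by rewrite actlDr actrDl actrM actlM actl_actr addrA.
Qed.

Lemma leibniz1l b : Delta one = 0 -> leibniz one b.
Proof. by rewrite /leibniz => ->; rewrite mul1l actl1 /actr linear0 addr0. Qed.

Lemma leibniz1r a : Delta one = 0 -> leibniz a one.
Proof. by rewrite /leibniz => ->; rewrite mul1r actr1 /actl linear0 add0r. Qed.

(** The rule for 1 = 1 1 reads Delta(1) = Delta(1) + Delta(1). *)
Lemma leibniz_one : leibniz one one -> Delta one = 0.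
Proof.
rewrite /leibniz mul1l actl1 actr1 => /eqP.
by rewrite -subr_eq0 opprD addNKr oppr_eq0 => /eqP.
Qed.

(** The two iterations of the coproduct are kept as maps on the tensor square,
    because their behaviour under the two actions is what matters. *)
Definition comul_l t := tassoc (tmap Delta idfun t).
Definition comul_r t := tmap idfun Delta t.
Definition coassociative_at a := comul_l (Delta a) = comul_r (Delta a).

Lemma comul_lE a b : comul_l (a ⊗ b) = tassoc (Delta a ⊗ b).
Proof. by rewrite /comul_l tmapE. Qed.
Lemma comul_rE a b : comul_r (a ⊗ b) = a ⊗ Delta b.
Proof. exact: tmapE. Qed.
Lemma comul_lD t u : comul_l (t + u) = comul_l t + comul_l u.
Proof. by rewrite /comul_l !linearD. Qed.
Lemma comul_rD t u : comul_r (t + u) = comul_r t + comul_r u.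
Proof. exact: linearD. Qed.
Lemma comul_lZ (c : k) t : comul_l (c *: t) = c *: comul_l t.
Proof. by rewrite /comul_l !linearZ. Qed.
Lemma comul_rZ (c : k) t : comul_r (c *: t) = c *: comul_r t.
Proof. exact: linearZ. Qed.

Lemma coassociative_at_linear (c : k) a b :
  coassociative_at a -> coassociative_at b -> coassociative_at (c *: a + b).
Proof.
rewrite /coassociative_at => Ha Hb.
by rewrite linearP comul_lD comul_rD comul_lZ comul_rZ Ha Hb.
Qed.

Lemma coassociative_at_one : Delta one = 0 -> coassociative_at one.
Proof.
by rewrite /coassociative_at /comul_l /comul_r => ->; rewrite !linear0.
Qed.

Lemma coassociative_at_leaf a :
  Delta one = 0 -> Delta a = one ⊗ one -> coassociative_at a.
Proof.
rewrite /coassociative_at => D1 ->; rewrite comul_lE comul_rE D1.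
by rewrite pure0l pure0r linear0.
Qed.

Section Product.
Hypothesis DeltaM : forall a b, leibniz a b.

Definition actl_on t a := actl a t.
HB.instance Definition _ t :=
  GRing.isLinear.Build k M (M ⊠ M) *:%R (actl_on t) (actl_linear t).

(** [cross] is the bilinear map (a1 (x) a2, b1 (x) b2) |-> a1 (x) a2 b1 (x) b2:
    the mixed term that both iterated coproducts of a product contain. *)
Definition cross t u := tmap idfun (actl_on u) t.
Definition actl3 a (z : M ⊠ (M ⊠ M)) := tmap (mull a) idfun z.
Definition actr3 a (z : M ⊠ (M ⊠ M)) := tmap idfun (tmap idfun (mulr a)) z.

Lemma crossE a b u : cross (a ⊗ b) u = a ⊗ actl b u.
Proof. exact: tmapE. Qed.
Lemma crossDl t s u : cross (t + s) u = cross t u + cross s u.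
Proof. exact: linearD. Qed.
Lemma crossDr t u v : cross t (u + v) = cross t u + cross t v.
Proof.
elim/tprod_ind: t => [t s Ht Hs|a b]; last by rewrite !crossE actlDr pureDr.
by rewrite !crossDl Ht Hs addrACA.
Qed.
Lemma actl3E a b t : actl3 a (b ⊗ t) = mull a b ⊗ t.
Proof. exact: tmapE. Qed.
Lemma actr3E a b t : actr3 a (b ⊗ t) = b ⊗ actr t a.
Proof. exact: tmapE. Qed.
Lemma actl3D a (y z : M ⊠ (M ⊠ M)) : actl3 a (y + z) = actl3 a y + actl3 a z.
Proof. exact: linearD. Qed.
Lemma actr3D a (y z : M ⊠ (M ⊠ M)) : actr3 a (y + z) = actr3 a y + actr3 a z.
Proof. exact: linearD. Qed.

Lemma tassoc_actl a t c : tassoc (actl a t ⊗ c) = actl3 a (tassoc (t ⊗ c)).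
Proof.
elim/tprod_ind: t => [t u|b d]; last by rewrite actlE !tassocE actl3E.
by rewrite actlDr !pureDl !tassocD actl3D => -> ->.
Qed.

Lemma tassoc_actr t b c : tassoc (actr t b ⊗ c) = cross t (b ⊗ c).
Proof.
elim/tprod_ind: t => [t u|a d]; last by rewrite actrE tassocE crossE actlE.
by rewrite actrDl !pureDl !tassocD crossDl => -> ->.
Qed.

Lemma tassoc_mulr t c a : tassoc (t ⊗ mull c a) = actr3 a (tassoc (t ⊗ c)).
Proof.
elim/tprod_ind: t => [t u|b d]; last by rewrite !tassocE actr3E actrE.
by rewrite !pureDl !tassocD actr3D => -> ->.
Qed.

(** Only when the left action meets the leftmost coproduct does the Leibniz rule
    intervene; the symmetric statement is [comul_r_actr], and in the two
    other combinations the action and the coproduct touch different factors. *)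
Lemma comul_l_actl a t :
  comul_l (actl a t) = actl3 a (comul_l t) + cross (Delta a) t.
Proof.
elim/tprod_ind: t => [t u|b c].
  by rewrite actlDr !comul_lD actl3D crossDr addrACA => -> ->.
by rewrite actlE !comul_lE DeltaM pureDl !tassocD tassoc_actl tassoc_actr.
Qed.

Lemma comul_l_actr a t : comul_l (actr t a) = actr3 a (comul_l t).
Proof.
elim/tprod_ind: t => [t u|b c]; last by rewrite actrE !comul_lE tassoc_mulr.
by rewrite actrDl !comul_lD actr3D => -> ->.
Qed.

Lemma comul_r_actl a t : comul_r (actl a t) = actl3 a (comul_r t).
Proof.
elim/tprod_ind: t => [t u|b c]; last by rewrite actlE !comul_rE actl3E.
by rewrite actlDr !comul_rD actl3D => -> ->.
Qed.

Lemma comul_r_actr a t :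
  comul_r (actr t a) = cross t (Delta a) + actr3 a (comul_r t).
Proof.
elim/tprod_ind: t => [t u|b c].
  by rewrite actrDl !comul_rD actr3D crossDl addrACA => -> ->.
by rewrite actrE !comul_rE DeltaM pureDr crossE actr3E.
Qed.

(** The mixed terms are equal and appear on both sides; what is left is the
    assumption at b acted upon by a, and the assumption at a acted upon by b. *)
Lemma coassociative_at_mul a b :
  coassociative_at a -> coassociative_at b -> coassociative_at (mull a b).
Proof.
rewrite /coassociative_at => Ha Hb; rewrite DeltaM comul_lD comul_rD.
by rewrite comul_l_actl comul_l_actr comul_r_actl comul_r_actr Ha Hb addrA.
Qed.
End Product.

Definition cocycle_at (P : {linear M -> M}) a :=
  Delta (P a) = a ⊗ one + tmap idfun P (Delta a).

Section Operator.
Variable P : {linear M -> M}.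

Lemma cocycle_at_linear (c : k) a b :
  cocycle_at P a -> cocycle_at P b -> cocycle_at P (c *: a + b).
Proof.
rewrite /cocycle_at => Ha Hb; rewrite !linearP /= Ha Hb.
by rewrite pureDl pureZl scalerDr addrACA.
Qed.

Definition op3 (z : M ⊠ (M ⊠ M)) := tmap idfun (tmap idfun P) z.
Lemma op3D (y z : M ⊠ (M ⊠ M)) : op3 (y + z) = op3 y + op3 z.
Proof. exact: tmapD. Qed.
Lemma op3E a t : op3 (a ⊗ t) = a ⊗ tmap idfun P t.
Proof. exact: tmapE. Qed.

Lemma comul_l_op t : comul_l (tmap idfun P t) = op3 (comul_l t).
Proof.
elim/tprod_ind: t => [t u|b c].
  by rewrite !tmapD !comul_lD op3D => -> ->.
rewrite tmapE !comul_lE; elim/tprod_ind: (Delta b) => [t u|d e].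
  by rewrite !pureDl !tassocD op3D => -> ->.
by rewrite !tassocE op3E tmapE.
Qed.

Hypothesis DeltaP : forall a, cocycle_at P a.

(** P sits on the last factor, where the coproduct is applied: the cocycle rule
    then contributes the extra term with 1 in the last position. *)
Lemma comul_r_op t :
  comul_r (tmap idfun P t) = tassoc (t ⊗ one) + op3 (comul_r t).
Proof.
elim/tprod_ind: t => [t u|b c].
  by rewrite !tmapD !comul_rD pureDl !tassocD op3D addrACA => -> ->.
by rewrite tmapE !comul_rE tassocE DeltaP pureDr op3E.
Qed.

(** The extra term of [comul_r_op] at Delta(a) is matched by the coproduct of the
    first factor of a (x) 1, while id (x) Delta kills a (x) 1. *)
Lemma coassociative_at_op a :
  Delta one = 0 -> coassociative_at a -> coassociative_at (P a).
Proof.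
rewrite /coassociative_at => D1 Ha; rewrite DeltaP comul_lD comul_rD.
by rewrite comul_l_op comul_r_op Ha comul_lE comul_rE D1 pure0r add0r.
Qed.
End Operator.
End OneAlgebra.

(** * Morphisms and coproducts *)

Section Morphism.
Variables (M N : lmodType k).
Variables (mull mulr : M -> {linear M -> M}) (one : M).
Variable Delta : {linear M -> M ⊠ M}.
Variables (null nulr : N -> {linear N -> N}) (neu : N).
Variable Gamma : {linear N -> N ⊠ N}.
Variable phi : {linear M -> N}.
Hypothesis mulrE : forall a b, mulr b a = mull a b.
Hypothesis nulrE : forall a b, nulr b a = null a b.
Hypothesis phiM : forall a b, phi (mull a b) = null (phi a) (phi b).
Hypothesis phi1 : phi one = neu.

Lemma tmap_actl a t :
  tmap phi phi (actl mull a t) = actl null (phi a) (tmap phi phi t).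
Proof.
elim/tprod_ind: t => [t u|b c]; last by rewrite actlE !tmapE actlE phiM.
by rewrite actlDr !tmapD actlDr => -> ->.
Qed.

Lemma tmap_actr a t :
  tmap phi phi (actr mulr t a) = actr nulr (tmap phi phi t) (phi a).
Proof.
elim/tprod_ind: t => [t u|b c].
  by rewrite actrDl !tmapD actrDl => -> ->.
by rewrite (actrE mulrE) !tmapE (actrE nulrE) phiM.
Qed.

Definition comul_compatible a := Gamma (phi a) = tmap phi phi (Delta a).

Lemma comul_compatible_linear (c : k) a b :
  comul_compatible a -> comul_compatible b -> comul_compatible (c *: a + b).
Proof. by rewrite /comul_compatible => Ha Hb; rewrite !linearP /= Ha Hb. Qed.

Lemma comul_compatible_one :
  Delta one = 0 -> Gamma neu = 0 -> comul_compatible one.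
Proof. by rewrite /comul_compatible phi1 => -> ->; rewrite linear0. Qed.

Lemma comul_compatible_leaf a :
  Delta a = one ⊗ one -> Gamma (phi a) = neu ⊗ neu -> comul_compatible a.
Proof. by rewrite /comul_compatible => -> ->; rewrite tmapE phi1. Qed.

Lemma comul_compatible_mul a b :
  leibniz mull mulr Delta a b -> leibniz null nulr Gamma (phi a) (phi b) ->
  comul_compatible a -> comul_compatible b -> comul_compatible (mull a b).
Proof.
rewrite /comul_compatible phiM => -> -> -> ->.
by rewrite !tmapD tmap_actl tmap_actr.
Qed.

Lemma comul_compatible_op (P : {linear M -> M}) (Q : {linear N -> N}) a :
  (forall b, phi (P b) = Q (phi b)) ->
  cocycle_at one Delta P a -> cocycle_at neu Gamma Q (phi a) ->
  comul_compatible a -> comul_compatible (P a).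
Proof.
rewrite /comul_compatible => phiP -> DQ Ha; rewrite phiP DQ Ha tmapD tmapE phi1.
congr (_ + _); elim/tprod_ind: (Delta a) => [t u|b c].
  by rewrite !tmapD => -> ->.
by rewrite !tmapE phiP.
Qed.
End Morphism.
End Comultiplication.

(** * The quotient construction of the tensor product *)

Section ConcreteTensors.
Local Open Scope tensor_scope.
Variables (k : comPzRingType).

(** A class in the quotient is a linear combination of classes of pairs, and a
    scalar can be moved into the first factor; so sums of pure tensors suffice,
    the empty sum being 0 (x) 0. *)
Lemma tensor_ind (A B : lmodType k) (P : (A ⊗ B)%type -> Prop) :
  (forall t u, P t -> P u -> P (t + u)) -> (forall a b, P (a ⊗ b)) ->
  forall t, P t.
Proof.
move=> PD Pt t; rewrite -[t]treprK [trepr t]free_modE linear_sum /=.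
have tensZl (c : k) (a : A) (b : B) : (c *: a) ⊗ b = c *: (a ⊗ b).
  exact: (scalable_linear ((tens_bilinear A B).1 b)).
apply: big_ind => [|//|[a b] _].
  by rewrite -(scale0r (0 ⊗ 0)) -tensZl.
by rewrite linearZ /= -/(tens a b) -tensZl.
Qed.

Definition tensor_product : tensor_theory k := TensorTheory
  (tprod := fun A B : lmodType k => (A ⊗ B)%type)
  (@tens_bilinear k) tensor_ind
  (fun A A' B B' f g => tensor_lift_linear (tens_map_bilinear f g))
  (@tens_mapE k)
  (fun A B C => tensor_lift_linear (@tens_assoc_bilinear k A B C))
  (@tens_assocE k).
End ConcreteTensors.

(** * Generation of the algebra of forests *)

Section ForestInduction.
Variables (k : comPzRingType) (X Omega : choiceType).
Local Notation H := (H_RT k X Omega).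

Lemma forest_elt_ind (P : H -> Prop) :
  (forall (c : k) a b, P a -> P b -> P (c *: a + b)) ->
  (forall F, P (forest_elt k F)) -> forall a, P a.
Proof.
move=> PP PF a.
have P0 : P 0.
  by rewrite -(addNr (forest_elt k [::])) -scaleN1r; apply: PP.
rewrite (free_modE a); apply: big_rec => [|F b _]; first exact: P0.
exact/PP/PF.
Qed.

Lemma forest_tree_ind (P : H -> Prop) :
  (forall (c : k) a b, P a -> P b -> P (c *: a + b)) ->
  P 1 -> (forall a b, P a -> P b -> P (a * b)) ->
  (forall T, P (forest_elt k [:: T])) -> forall a, P a.
Proof.
move=> PP P1 PM PT; apply: forest_elt_ind => // F.
elim: F => [|T F IHF]; first exact: P1.
by have := PM _ _ (PT T) IHF; rewrite -forest_elt_cat.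
Qed.

(** H_RT is generated by the leaves under linear combinations, products and
    grafting.  The recursion is on trees, with an inner induction on the list of
    subtrees, since trees are nested in lists. *)
Lemma forest_algebra_ind (P : H -> Prop) :
  (forall (c : k) a b, P a -> P b -> P (c *: a + b)) ->
  P 1 -> (forall a b, P a -> P b -> P (a * b)) ->
  (forall x, P (j_X k Omega x)) -> (forall w a, P a -> P (Bplus k w a)) ->
  forall a, P a.
Proof.
move=> PP P1 PM Pj PB; apply: (forest_tree_ind PP P1 PM).
fix IH 1 => -[x|w F]; first exact: Pj.
rewrite -Bplus_forest; apply: PB.
elim: F => [|T F IHF]; first exact: P1.
by have := PM _ _ (IH T) IHF; rewrite -forest_elt_cat.
Qed.
End ForestInduction.

Section UAlgebras.
Variables (k : comPzRingType) (A : ualgType k).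
Definition lmul (a : A) : {linear A -> A} := ualg_mull a.
Definition rmul (a : A) : {linear A -> A} := ualg_mulr a.

Lemma rmul_lmul (a b : A) : rmul b a = lmul a b. Proof. by []. Qed.
Lemma lmulA (a b c : A) : lmul (lmul a b) c = lmul a (lmul b c).
Proof. exact/esym/mulrA. Qed.
End UAlgebras.

(** * The bialgebra of forests *)

Section ForestBialgebra.
Variables (k : comPzRingType) (X Omega : choiceType).
Local Notation H := (H_RT k X Omega).
Local Notation Delta := (Delta_eps k X Omega).
Local Notation T := (tensor_product k).
Local Notation ml := (@lmul k H).
Local Notation mr := (@rmul k H).
Let mlr := @rmul_lmul k H.
Let Delta1 : Delta 1 = 0 := Delta_eps_one k X Omega.

(** The recursive definition is the rule for a single tree against a nonempty
    forest.  Linearity in the second argument, then products and linearity in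
    the first, extend it; the empty forest is covered by Delta(1) = 0. *)
Lemma Delta_eps_leibniz (a b : H) : @leibniz k T H ml mr Delta a b.
Proof.
move: a b; apply: forest_tree_ind.
- move=> c a a' Ha Ha' b.
  exact: (@leibniz_linearl k T H ml mr mlr Delta c a a' b (Ha b) (Ha' b)).
- move=> b; exact: (@leibniz1l k T H ml mr 1 (@mul1r H) Delta b Delta1).
- move=> a a' Ha Ha' b.
  exact: (@leibnizMl k T H ml mr mlr (@lmulA k H) Delta a a' b
            (Ha a') (Ha (ml a' b)) (Ha' b)).
move=> t; apply: forest_elt_ind => [c b b'|[|t' F]].
- exact: (@leibniz_linearr k T H ml mr mlr Delta).
- exact: (@leibniz1r k T H ml mr 1 mlr (@mulr1 H) Delta _ Delta1).
have := @Delta_eps_cons k X Omega t (t' :: F) isT.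
exact: etrans (congr1 Delta (esym (forest_elt_cat k [:: t] (t' :: F)))).
Qed.

Lemma Delta_eps_cocycle w (a : H) : @cocycle_at k T H 1 Delta (Bplus k w) a.
Proof.
move: a; apply: forest_elt_ind; last exact: Delta_eps_Bplus.
exact: (@cocycle_at_linear k T H 1 Delta (Bplus k w)).
Qed.

Lemma Delta_eps_coassociative (a : H) : @coassociative_at k T H Delta a.
Proof.
move: a; apply: forest_algebra_ind.
- exact: (@coassociative_at_linear k T H Delta).
- exact: (@coassociative_at_one k T H 1 Delta Delta1).
- exact: (@coassociative_at_mul k T H ml mr mlr Delta Delta_eps_leibniz).
- move=> x.
  exact: (@coassociative_at_leaf k T H 1 Delta _ Delta1 (Delta_eps_leaf _ _ x)).
- move=> w a.
  exact: (@coassociative_at_op k T H 1 Delta (Bplus k w) (Delta_eps_cocycle w)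
            a Delta1).
Qed.

Lemma forest_cocycle_bialgebra :
  @cocycle_inf_unitary_bialgebra k Omega 0 H Delta (fun w => Bplus k w).
Proof.
split; last exact: Delta_eps_cocycle.
split; first exact: Delta_eps_coassociative.
move=> a b; apply: (etrans (Delta_eps_leibniz a b)).
by rewrite scale0r addr0.
Qed.
End ForestBialgebra.

(** * The universal morphism *)

Section UniversalMorphism.
Variables (k : comPzRingType) (X Omega : choiceType).
Variables (A : ualgType k) (P : Omega -> {linear A -> A}) (f : X -> A).
Local Notation H := (H_RT k X Omega).

Fixpoint tree_map (t : dtree X Omega) : A :=
  match t with
  | Leaf x => f x
  | Node w F => P w (foldr (fun t a => tree_map t * a) 1 F)
  end.

Definition forest_product F : A := foldr (fun t a => tree_map t * a) 1 F.

Lemma forest_product_cat F G :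
  forest_product (F ++ G) = forest_product F * forest_product G.
Proof. by elim: F => [|t F IH] /=; rewrite ?mul1r // IH mulrA. Qed.

Definition forest_map : {linear H -> A} := free_lift forest_product.

Lemma forest_map_elt F : forest_map (forest_elt k F) = forest_product F.
Proof. exact: free_lift_basis. Qed.

Lemma forest_map1 : forest_map 1 = 1.
Proof. exact: (forest_map_elt [::]). Qed.

Lemma forest_mapM (a b : H) : forest_map (a * b) = forest_map a * forest_map b.
Proof.
move: a b; apply: forest_elt_ind => [c a a' Ha Ha' b|F].
  by rewrite mulrDl -ualg_scaleAl !linearP Ha Ha' mulrDl ualg_scaleAl.
apply: forest_elt_ind => [c b b' Hb Hb'|G].
  by rewrite mulrDr -ualg_scaleAr !linearP Hb Hb' mulrDr ualg_scaleAr.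
by rewrite -forest_elt_cat !forest_map_elt forest_product_cat.
Qed.

Lemma forest_map_Bplus w a : forest_map (Bplus k w a) = P w (forest_map a).
Proof.
move: a; apply: forest_elt_ind => [c a b Ha Hb|F].
  by rewrite !linearP Ha Hb.
by rewrite Bplus_forest !forest_map_elt /= mulr1.
Qed.

Lemma forest_map_j x : forest_map (j_X k Omega x) = f x.
Proof. by rewrite forest_map_elt /= mulr1. Qed.

Lemma forest_map_unique (psi : {linear H -> A}) :
  psi 1 = 1 -> {morph psi : a b / a * b} ->
  (forall w a, psi (Bplus k w a) = P w (psi a)) ->
  (forall x, psi (j_X k Omega x) = f x) -> forest_map =1 psi.
Proof.
move=> psi1 psiM psiB psij; apply: forest_algebra_ind.
- by move=> c a b Ha Hb; rewrite !linearP Ha Hb.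
- by rewrite forest_map1 psi1.
- by move=> a b Ha Hb; rewrite forest_mapM psiM Ha Hb.
- by move=> x; rewrite forest_map_j psij.
- by move=> w a Ha; rewrite forest_map_Bplus psiB Ha.
Qed.

Lemma forest_map_comul (Gamma : comultiplication A) :
  cocycle_inf_unitary_bialgebra 0 Gamma P ->
  (forall x, Gamma (f x) = tens (1 : A) (1 : A)) ->
  forall a, Gamma (forest_map a) =
    tens_map forest_map forest_map (Delta_eps k X Omega a).
Proof.
move=> [[_ GammaM0] GammaP] Gammaf.
pose T := tensor_product k; pose Delta := Delta_eps k X Omega.
pose phi := forest_map.
have GammaM (a b : A) : @leibniz k T A (@lmul k A) (@rmul k A) Gamma a b.
  by apply: (etrans (GammaM0 a b)); rewrite scale0r addr0.
have Gamma1 : Gamma 1 = 0.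
  exact: (@leibniz_one k T A (@lmul k A) (@rmul k A) 1 (@rmul_lmul k A)
            (@mul1r A) (@mulr1 A) Gamma (GammaM 1 1)).
apply: forest_algebra_ind.
- exact: (@comul_compatible_linear k T H A Delta Gamma phi).
- exact: (@comul_compatible_one k T H A 1 Delta 1 Gamma phi forest_map1
            (Delta_eps_one _ _ _) Gamma1).
- move=> a b.
  exact: (@comul_compatible_mul k T H A (@lmul k H) (@rmul k H) Delta
            (@lmul k A) (@rmul k A) Gamma phi (@rmul_lmul k H) (@rmul_lmul k A)
            forest_mapM a b (Delta_eps_leibniz a b) (GammaM _ _)).
- move=> x.
  apply: (@comul_compatible_leaf k T H A 1 Delta 1 Gamma phi forest_map1).
    exact: Delta_eps_leaf.
  by rewrite /phi forest_map_j; exact: Gammaf.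
- move=> w a.
  exact: (@comul_compatible_op k T H A 1 Delta 1 Gamma phi forest_map1
            (Bplus k w) (P w) a (forest_map_Bplus w) (Delta_eps_cocycle w a)
            (GammaP w (phi a))).
Qed.
End UniversalMorphism.

Theorem theorem4p19 (k : comPzRingType) (Omega X : choiceType)
    (Omega_nonempty : inhabited Omega) :
  @free_cocycle_inf_unitary_bialgebra k Omega 0 X (H_RT k X Omega)
    (Delta_eps k X Omega) (fun w => Bplus k w) (j_X k Omega).
Proof.
split=> [|A Gamma P bialgA f Gammaf]; first exact: forest_cocycle_bialgebra.
exists (forest_map P f); split.
  split; last by apply/boolp.funext => x; exact: forest_map_j.
  split; [exact: linearP | exact: forest_map1 | exact: forest_mapM | |].
    exact: forest_map_comul.
  exact: forest_map_Bplus.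
move=> psi [[psi_lin psi1 psiM _ psiB] psij].
pose lpsi : {linear H_RT k X Omega -> A} :=
  HB.pack psi (GRing.isLinear.Build _ _ _ _ psi psi_lin).
apply/boolp.funext/(@forest_map_unique k X Omega A P f lpsi) => // x.
by rewrite -psij.
Qed.
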